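(* Let $\alpha>-1$, $\beta>-1$ be real and let $P_n(x)=P_n^{(-1)}(x)$, $n=0,1,2,\dots$, be the monic little $-1$ Jacobi polynomials with parameters $(\alpha,\beta)$. Let $$L_0=2(1-x)\partial_xR+(\alpha+\beta+1-\alpha x^{-1})(1-R),$$ where $R$ is the reflection operator $Rf(x)=f(-x)$. Then for every $n\ge0$, $$L_0P_n(x)=\lambda_nP_n(x),\qquad \lambda_n=\begin{cases}-2n,& n\text{ even},\\ 2(\alpha+\beta+n+1),& n\text{ odd}.\end{cases}$$
   Context: The little $-1$ Jacobi polynomials with parameters $(\alpha,\beta)$ are the monic polynomials defined by $P_{-1}=0$, $P_0=1$, $P_{n+1}(x)+b_nP_n(x)+u_nP_{n-1}(x)=xP_n(x)$ with $$u_n=\frac{(n+(1-\theta_n)\alpha)(n+\beta+\theta_n\alpha)}{(2n+\alpha+\beta)^2},\quad b_n=(-1)^n\frac{(2n+1)\alpha+\alpha\beta+\alpha^2+(-1)^n\beta}{(2n+\alpha+\beta)(2n+2+\alpha+\beta)},\quad \theta_n=\frac{1+(-1)^n}{2}$$ (with $b_0=\frac{\alpha+1}{\alpha+\beta+2}$, which is the value of the formula at $n=0$ when $\alpha+\beta\ne0$). Equivalently, they are the monic polynomials orthogonal on $[-1,1]$ with respect to the weight $|x|^{\alpha}(1-x^2)^{(\beta-1)/2}(1+x)$. In $L_0$, $\partial_xR$ means first apply $R$ and then differentiate, and functions of $x$ act by multiplication; $L_0$ maps polynomials to polynomials. *)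

(* Defs.v *)
From HB Require Import structures.
From mathcomp Require Import all_boot all_order all_algebra.
From mathcomp Require Import reals ring lra.
Set Implicit Arguments.
Unset Strict Implicit.
Unset Printing Implicit Defensive.
Import Order.TTheory GRing.Theory Num.Theory.
Local Open Scope ring_scope.

Section LittleMinusOneJacobi.
Variables (R : realType) (alpha beta : R).

Definition theta (n : nat) : R := (1 + (-1) ^+ n) / 2.

Definition u_coef (n : nat) : R :=
  (n%:R + (1 - theta n) * alpha) * (n%:R + beta + theta n * alpha)
    / (2 * n%:R + alpha + beta) ^+ 2.

(* The value at n = 0 is given separately: the general formula is 0 / 0 when
   alpha + beta = 0, and agrees with this value otherwise (b_coef0E below). *)
Definition b_coef (n : nat) : R :=
  if n == 0%N then (alpha + 1) / (alpha + beta + 2)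
  else (-1) ^+ n
       * (((2 * n%:R + 1) * alpha + alpha * beta + alpha ^+ 2
           + (-1) ^+ n * beta)
          / ((2 * n%:R + alpha + beta) * (2 * n%:R + 2 + alpha + beta))).

(* The recurrence P_{n+1} + b_n P_n + u_n P_{n-1} = x P_n solved for P_{n+1},
   with P_{-1} = 0. *)
Fixpoint little_m1_jacobi (n : nat) : {poly R} :=
  if n is m.+1 then
    'X * little_m1_jacobi m - b_coef m *: little_m1_jacobi m
      - u_coef m *: (if m is k.+1 then little_m1_jacobi k else 0)
  else 1.

Definition reflp (f : {poly R}) : {poly R} := f \Po (- 'X).

(* Multiplication by x^-1 is only ever applied to f - R f, which has no constant
   term, so it is the exact division by 'X (dvdX_subr_reflp, horner_L0). *)
Definition L0 (f : {poly R}) : {poly R} :=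
  2 *: ((1 - 'X) * (reflp f)^`())
    + (alpha + beta + 1) *: (f - reflp f)
    - alpha *: ((f - reflp f) %/ 'X).

Definition eigval (n : nat) : R :=
  if odd n then 2 * (alpha + beta + n%:R + 1) else - (2 * n%:R).

Lemma b_coef0E : -1 < alpha -> -1 < beta -> alpha + beta != 0 ->
  b_coef 0 = (-1) ^+ 0
       * (((2 * 0%:R + 1) * alpha + alpha * beta + alpha ^+ 2
           + (-1) ^+ 0 * beta)
          / ((2 * 0%:R + alpha + beta) * (2 * 0%:R + 2 + alpha + beta))).
Proof.
move=> a1 b1 ab0; rewrite /b_coef /=; field.
have ab2 : 0 < alpha + beta + 2 by lra.
by rewrite ab0 andbT; apply: lt0r_neq0; lra.
Qed.

Lemma dvdX_subr_reflp (f : {poly R}) : 'X %| f - reflp f.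
Proof.
by rewrite -['X]subr0 -polyC0 dvdp_XsubCl /root !hornerE horner_comp !hornerE
           oppr0 subrr.
Qed.

Lemma horner_L0 (f : {poly R}) (x : R) : x != 0 ->
  (L0 f).[x] = 2 * (1 - x) * (reflp f)^`().[x]
               + (alpha + beta + 1 - alpha * x^-1) * (f.[x] - f.[- x]).
Proof.
move=> x0; have rx : (reflp f).[x] = f.[- x].
  by rewrite horner_comp !hornerE.
have fx : f.[x] - f.[- x] = ((f - reflp f) %/ 'X).[x] * x.
  have /(congr1 (fun p => p.[x])) := divpK (dvdX_subr_reflp f).
  by rewrite !hornerE rx => ->.
by rewrite /L0 !hornerE rx fx /=; field.
Qed.

End LittleMinusOneJacobi.

(* Main.v *)
Require Import Defs.
From mathcomp Require Import all_boot all_order all_algebra.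
From mathcomp Require Import reals ring lra.
Set Implicit Arguments.
Unset Strict Implicit.
Unset Printing Implicit Defensive.
Import Order.TTheory GRing.Theory Num.Theory.
Local Open Scope ring_scope.

(** Besides [L0] consider [Z = (1 - x) R]. It anticommutes with [x], and
    [{x, L0} = 2 (alpha + beta + 1) x - 2 alpha - 2 Z].
    With [h_n = (alpha + (-1)^n beta) / (2n + alpha + beta)] and [h_0 = 1] the
    recurrence coefficients become [u_n = (1 - h_n^2) / 4] and
    [b_n = (-1)^n (h_n + h_{n+1}) / 2]. From [{x, Z} = 0] and the recurrence
    one gets, by induction, [Z P_n] as a combination of [P_n] and [P_{n-1}];
    substituting it in [L0 (x P_n)] gives the eigenvalue equation for
    [P_{n+1}] from those for [P_n] and [P_{n-1}]. *)

Section Operators.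
Variables (R : realType) (alpha beta : R).
Implicit Types (f g : {poly R}) (c : R).

Definition opZ f : {poly R} := (1 - 'X) * reflp f.

Lemma reflpB f g : reflp (f - g) = reflp f - reflp g.
Proof. exact: rmorphB. Qed.

Lemma reflpZ c f : reflp (c *: f) = c *: reflp f.
Proof. exact: comp_polyZ. Qed.

Lemma reflpX f : reflp ('X * f) = - ('X * reflp f).
Proof. by rewrite /reflp comp_polyM comp_polyX mulNr. Qed.

Lemma reflp1 : reflp 1 = 1 :> {poly R}.
Proof. exact: rmorph1. Qed.

Lemma opZB f g : opZ (f - g) = opZ f - opZ g.
Proof. by rewrite /opZ reflpB mulrBr. Qed.

Lemma opZZ c f : opZ (c *: f) = c *: opZ f.
Proof. by rewrite /opZ reflpZ scalerAr. Qed.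

Lemma opZX f : opZ ('X * f) = - ('X * opZ f).
Proof. by rewrite /opZ reflpX; ring. Qed.

Lemma L0B f g : L0 alpha beta (f - g) = L0 alpha beta f - L0 alpha beta g.
Proof.
have E : f - g - (reflp f - reflp g) = (f - reflp f) - (g - reflp g) by ring.
rewrite /L0 reflpB derivB E divpD divpN -!mul_polyC; ring.
Qed.

Lemma L0Z c f : L0 alpha beta (c *: f) = c *: L0 alpha beta f.
Proof.
rewrite /L0 reflpZ derivZ -scalerBr divpZl -!mul_polyC; ring.
Qed.

(** Multiplication by ['X] turns the odd part of [f] into an even one, so the quotient by ['X] for
    ['X * f] is [f + reflp f], with no division left. *)
Lemma L0X f : L0 alpha beta ('X * f) =
  (2 * (alpha + beta + 1)) *: ('X * f) - (2 * alpha) *: f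
  - 2 *: opZ f - 'X * L0 alpha beta f.
Proof.
have quoX : ('X * f - reflp ('X * f)) %/ 'X = f + reflp f.
  by rewrite reflpX opprK -mulrDr mulKp ?polyX_eq0.
have Xquo : 'X * ((f - reflp f) %/ 'X) = f - reflp f.
  by rewrite mulrC divpK ?dvdX_subr_reflp.
rewrite /L0 quoX mulrBr -[in RHS]scalerAr Xquo reflpX derivN derivM derivX.
by rewrite /opZ -!mul_polyC; ring.
Qed.

End Operators.

Section Eigenvectors.
Variables (R : realType) (alpha beta : R).
Hypotheses (halpha : -1 < alpha) (hbeta : -1 < beta).

Local Notation P := (little_m1_jacobi alpha beta).
Local Notation u := (u_coef alpha beta).
Local Notation b := (b_coef alpha beta).

Definition jacobi_pred n : {poly R} := if n is k.+1 then P k else 0.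
Local Notation Q := jacobi_pred.

(** At [n = 0] the quotient equals 1 except when [alpha + beta = 0], where it is 0 / 0; fixing 1
    covers both. *)
Definition h_coef n : R :=
  if n == 0%N then 1
  else (alpha + (-1) ^+ n * beta) / (2 * n%:R + alpha + beta).
Local Notation h := h_coef.

Lemma little_m1_jacobiS n : P n.+1 = 'X * P n - b n *: P n - u n *: Q n.
Proof. by []. Qed.

Lemma h_denom_gt0 n : 0 < 2 * n.+1%:R + alpha + beta.
Proof.
have : 0 <= n%:R :> R by [].
by rewrite -[n.+1%:R]natr1; move: halpha hbeta; lra.
Qed.

Lemma h_coef_gt0E n : h n.+1 =
  (alpha + (-1) ^+ n.+1 * beta) / (2 * n.+1%:R + alpha + beta).
Proof. by []. Qed.

Lemma b_coef_gt0E n : b n.+1 = (-1) ^+ n.+1 *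
  (((2 * n.+1%:R + 1) * alpha + alpha * beta + alpha ^+ 2
     + (-1) ^+ n.+1 * beta)
   / ((2 * n.+1%:R + alpha + beta) * (2 * n.+1%:R + 2 + alpha + beta))).
Proof. by []. Qed.

Lemma h_coefS n :
  h n.+1 = (alpha - (-1) ^+ n * beta) / (2 * n%:R + 2 + alpha + beta).
Proof.
by rewrite h_coef_gt0E exprS mulN1r mulNr -[n.+1%:R]natr1 mulrDr mulr1.
Qed.

(** Clearing denominators leaves [alpha + (-1) ^+ n * beta] and [alpha - (-1) ^+ n * beta]. At
    [n = 0] this survives [alpha + beta = 0], both sides of the first identity being 0. *)
Lemma h_coef_rec n :
  (2 * n%:R + alpha + beta) * h n + (2 * n%:R + 2 + alpha + beta) * h n.+1
  = 2 * alpha.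
Proof.
have d1 := h_denom_gt0 n; rewrite h_coefS.
have -> : (2 * n%:R + alpha + beta) * h n = alpha + (-1) ^+ n * beta.
  case: n {d1} => [|n]; first by rewrite /h_coef /=; ring.
  rewrite h_coef_gt0E; field.
  by apply: lt0r_neq0; have := h_denom_gt0 n; rewrite -[n.+1%:R]natr1; lra.
by field; apply: lt0r_neq0; move: d1; rewrite -[n.+1%:R]natr1; lra.
Qed.

Lemma b_coef_h n : 2 * (-1) ^+ n * b n = h n + h n.+1.
Proof.
have d1 := h_denom_gt0 n; rewrite h_coefS.
case: n d1 => [|n] d1.
  by rewrite /b_coef /h_coef /=; field; apply: lt0r_neq0; lra.
have d0 := h_denom_gt0 n; move: d0 d1.
rewrite b_coef_gt0E h_coef_gt0E -signr_odd -[n.+2%:R]natr1.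
(* With the index an opaque real and the sign fixed by parity, a rational identity in [m], [alpha],
   [beta] remains. *)
move: (n.+1%:R) => m d0 d1.
case: (odd _); rewrite ?expr1 ?expr0; field;
  apply/andP; split; apply: lt0r_neq0; lra.
Qed.

Lemma u_coef0 : u 0 = 0.
Proof.
have th0 : 1 - theta R 0 = 0 by rewrite /theta expr0; field.
by rewrite /u_coef th0 mul0r addr0 !mul0r.
Qed.

Lemma u_coef_h n : 4 * u n = 1 - h n ^+ 2.
Proof.
case: n => [|n]; first by rewrite u_coef0 /h_coef /=; ring.
have := h_denom_gt0 n.
rewrite h_coef_gt0E /u_coef /theta -signr_odd.
move: (n.+1%:R) => m d0.
by case: (odd _); rewrite ?expr1 ?expr0; field; apply: lt0r_neq0; lra.
Qed.

Lemma h_coefSE n : h n.+1 = 2 * (-1) ^+ n * b n - h n.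
Proof. by rewrite b_coef_h; ring. Qed.

(** Square [h_coefSE] inside [u_coef_h]. Both coefficients at [n.+1] are then polynomial in those at
    [n], so the inductions below end with [ring]. *)
Lemma u_coefS n : u n.+1 = u n + (-1) ^+ n * b n * h n - b n ^+ 2.
Proof.
have := u_coef_h n; have := u_coef_h n.+1; rewrite h_coefSE -signr_odd.
by case: (odd n); rewrite ?expr1 ?expr0 => ? ?; lra.
Qed.

(* The second relation fails at [n = 0], where [Q 0 = 0]; the factor
   [u 0 = 0] removes that case. *)
Lemma opZ_jacobi n :
  opZ (P n) = - ((-1) ^+ n *: ('X * P n)) + h n *: P n
              + (2 * (-1) ^+ n * u n) *: Q n
  /\ u n *: opZ (Q n) = u n *: ((2 * (-1) ^+ n) *: P n
              - (-1) ^+ n *: ('X * Q n) - h n *: Q n).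
Proof.
elim: n => [|n [ZP ZQ]].
  rewrite u_coef0 mulr0 !scale0r; split=> //.
  rewrite /opZ /= reflp1 /h_coef /= -!mul_polyC; ring.
split; last first.
  (* This is the first relation at [n], with [u n *: Q n] eliminated by the recurrence. *)
  congr (_ *: _); rewrite -[Q n.+1]/(P n) ZP h_coefSE little_m1_jacobiS exprS.
  rewrite -!mul_polyC -signr_odd; case: (odd n); rewrite ?expr1 ?expr0; ring.
(* Expanding [P n.+1] produces [opZ (Q n)] only with the factor [u n], so the weighted relation
   suffices. *)
rewrite -[Q n.+1]/(P n) {1}little_m1_jacobiS !opZB opZX !opZZ ZQ ZP.
rewrite u_coefS h_coefSE little_m1_jacobiS exprS.
rewrite -!mul_polyC -signr_odd; case: (odd n); rewrite ?expr1 ?expr0; ring.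
Qed.

Lemma eigvalE n : eigval alpha beta n
  = alpha + beta + 1 - (-1) ^+ n * (2 * n%:R + alpha + beta + 1).
Proof.
by rewrite /eigval -signr_odd; case: (odd n); rewrite ?expr1 ?expr0; ring.
Qed.

(** The induction needs two consecutive eigenvectors; the scalar on [Q n] is the [eigvalE] formula
    at [n - 1], and is harmless at [n = 0] since [Q 0 = 0]. *)
Lemma L0_jacobi n :
  L0 alpha beta (P n) = eigval alpha beta n *: P n
  /\ L0 alpha beta (Q n) =
     (alpha + beta + 1 + (-1) ^+ n * (2 * n%:R + alpha + beta - 1)) *: Q n.
Proof.
elim: n => [|n [LP LQ]].
  split; last by rewrite /= -[0](scale0r (1 : {poly R})) L0Z !scale0r scaler0.
  rewrite /L0 /= reflp1 subrr div0p derivC mulr0 !scaler0.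
  by rewrite eigvalE -mul_polyC; ring.
split; last first.
  rewrite -[Q n.+1]/(P n) LP eigvalE exprS -[n.+1%:R]natr1.
  by congr (_ *: _); ring.
have [ZP _] := opZ_jacobi n.
(* Equivalent to [2 * (alpha + h n) = b n * (eigval n.+1 - eigval n)], the matching of the
   coefficients of [P n]. *)
have hE : h n = (-1) ^+ n * b n * (2 * n%:R + 2 + alpha + beta) - alpha.
  by have := h_coef_rec n; rewrite h_coefSE; lra.
rewrite {1}little_m1_jacobiS !L0B L0X !L0Z LP LQ ZP hE.
rewrite little_m1_jacobiS !eigvalE exprS -[n.+1%:R]natr1.
rewrite -!mul_polyC -signr_odd; case: (odd n); rewrite ?expr1 ?expr0; ring.
Qed.

End Eigenvectors.

Theorem mainTheorem2 (R : realType) (alpha beta : R)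
  (halpha : -1 < alpha) (hbeta : -1 < beta) (n : nat) :
  L0 alpha beta (little_m1_jacobi alpha beta n)
  = eigval alpha beta n *: little_m1_jacobi alpha beta n.
Proof. by have [] := L0_jacobi halpha hbeta n. Qed.
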